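(* Let $P_2=ENEN$ and $P_5=NENE$, and let $$F_{2,5}(x_2,x_5,t)=1+\sum_{n\ge 1}t^n\sum_{L\in\mathcal{L}_n}x_2^{P_2\text{-mch}(L)}x_5^{P_5\text{-mch}(L)}.$$ Then $$F_{2,5}(x_2,x_5,t)=\left(1+\frac{1-\sqrt{1-4t}}{2-x_5\left(1-\sqrt{1-4t}\right)}\right)\left(1-\frac{2(1-x_5)t+(x_5-2)\left(1-\sqrt{1-4t}\right)}{1+\sqrt{1-4t}+x_2(x_5-1)\left(1-\sqrt{1-4t}\right)-x_5+\sqrt{1-4t}\,x_5+2(1-x_2x_5)t}\right).$$
   Context: $\mathcal{L}_n$ is the set of lattice paths from $(0,0)$ to $(n,n)$ consisting of unit north steps $N$ and unit east steps $E$, equivalently words with $n$ letters $E$ and $n$ letters $N$. For $L\in\mathcal{L}_n$ and $A\subseteq\{1,\dots,n\}$, $ps_L(A)$ is the word obtained from $L$ by deleting, for every $i\in\{1,\dots,n\}\setminus A$, the $i$-th occurrence of $E$ and the $i$-th occurrence of $N$ (reading from left to right). For $P\in\mathcal{L}_2$, $P\text{-mch}(L)$ is the number of $j\in\{1,\dots,n-1\}$ with $ps_L(\{j,j+1\})=P$. Identities are between formal power series in $t$ with coefficients polynomial in $x_2,x_5$; $\sqrt{1-4t}$ denotes the formal power series square root with constant term $1$. *)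

(* Defs.v *)
From HB Require Import structures.
From mathcomp Require Import all_boot all_algebra.
From mathcomp Require Import boolp mpoly.

Set Implicit Arguments.
Unset Strict Implicit.
Unset Printing Implicit Defensive.

Import GRing.Theory.

(** * Lattice paths *)

(* Steps are booleans, so that words of steps inherit the eqType and finType
   structures of sequences and tuples over [bool]. *)
Definition step : Type := bool.
HB.instance Definition _ := Finite.on step.
Definition E : step := true.
Definition N : step := false.

Definition lattice_paths (n : nat) : {set (n + n).-tuple step} :=
  [set L : (n + n).-tuple step | (count_mem E L == n) && (count_mem N L == n)].

(* If the letter at position [k] of [w] (counted from 0) is the [i]-th
   occurrence (counted from 1) of that letter in [w], then [occ w k = i]. *)
Definition occ (w : seq step) (k : nat) : nat :=
  count_mem (nth E w k) (take k.+1 w).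

Definition ps (w : seq step) (A : {pred nat}) : seq step :=
  mask [seq occ w k \in A | k <- iota 0 (size w)] w.

Definition mch (n : nat) (P : seq step) (L : (n + n).-tuple step) : nat :=
  count (fun j => ps L (pred2 j j.+1) == P) (iota 1 n.-1).
Arguments mch : clear implicits.

Definition P2 : seq step := [:: E; N; E; N].
Definition P5 : seq step := [:: N; E; N; E].

(** * Formal power series in one variable *)

Local Open Scope ring_scope.

Record fps (R : Type) : Type := Fps { fcoef : nat -> R }.

HB.instance Definition _ (R : Type) := gen_eqMixin (fps R).
HB.instance Definition _ (R : Type) := gen_choiceMixin (fps R).

Lemma fpsP (R : Type) (f g : fps R) : fcoef f =1 fcoef g <-> f = g.
Proof. by case: f g => [f] [g]; split=> [/= /funext -> | ->]. Qed.

Section Zmodule.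
Variable R : zmodType.
Implicit Types f g h : fps R.

Definition fps_zero : fps R := Fps (fun=> 0).
Definition fps_opp f : fps R := Fps (fun n => - fcoef f n).
Definition fps_add f g : fps R := Fps (fun n => fcoef f n + fcoef g n).

Fact fps_addA : associative fps_add.
Proof. by move=> f g h; apply/fpsP=> n; apply: addrA. Qed.
Fact fps_addC : commutative fps_add.
Proof. by move=> f g; apply/fpsP=> n; apply: addrC. Qed.
Fact fps_add0 : left_id fps_zero fps_add.
Proof. by move=> f; apply/fpsP=> n; apply: add0r. Qed.
Fact fps_addN : left_inverse fps_zero fps_opp fps_add.
Proof. by move=> f; apply/fpsP=> n; apply: addNr. Qed.

HB.instance Definition _ :=
  GRing.isZmodule.Build (fps R) fps_addA fps_addC fps_add0 fps_addN.

Lemma fcoef0 n : fcoef (0 : fps R) n = 0. Proof. by []. Qed.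
Lemma fcoefN f n : fcoef (- f) n = - fcoef f n. Proof. by []. Qed.
Lemma fcoefD f g n : fcoef (f + g) n = fcoef f n + fcoef g n.
Proof. by []. Qed.
Lemma fcoefB f g n : fcoef (f - g) n = fcoef f n - fcoef g n.
Proof. by []. Qed.
End Zmodule.

Definition fpsC (R : nmodType) (c : R) : fps R :=
  Fps (fun n => if n == 0%N then c else 0).

Definition fpsX (R : pzSemiRingType) : fps R := Fps (fun n => (n == 1%N)%:R).
Arguments fpsX {R}.

Section ComRing.
Variable R : comNzRingType.
Implicit Types f g h : fps R.

Definition fps_one : fps R := fpsC 1.
Definition fps_mul f g : fps R :=
  Fps (fun n => \sum_(i < n.+1) fcoef f i * fcoef g (n - i)).

Let trunc n f : {poly R} := \poly_(i < n.+1) fcoef f i.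

Let fps_mul_trunc n f g i : (i <= n)%N ->
  fcoef (fps_mul f g) i = (trunc n f * trunc n g)`_i.
Proof.
move=> le_in; rewrite coefM /=; apply: eq_bigr => j _; rewrite !coef_poly.
by rewrite !ltnS (leq_trans (leq_subr _ _) le_in) (leq_trans _ le_in) // -ltnS.
Qed.

Fact fps_mulC : commutative fps_mul.
Proof.
by move=> f g; apply/fpsP=> n; rewrite !(@fps_mul_trunc n) // mulrC.
Qed.
Fact fps_mulA : associative fps_mul.
Proof.
move=> f g h; apply/fpsP=> n.
transitivity (trunc n f * (trunc n g * trunc n h))`_n.
  rewrite coefM /=; apply: eq_bigr => j _; congr (_ * _).
    by rewrite coef_poly ltn_ord.
  by rewrite -(@fps_mul_trunc n) ?leq_subr.
rewrite mulrA coefM /=; apply: eq_bigr => j _; congr (_ * _).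
  by rewrite -(@fps_mul_trunc n) // -ltnS.
by rewrite coef_poly ltnS leq_subr.
Qed.
Fact fps_mul1 : left_id fps_one fps_mul.
Proof.
move=> f; apply/fpsP=> n /=; rewrite big_ord_recl /= mul1r subn0.
by rewrite big1 ?addr0 // => i _; rewrite mul0r.
Qed.
Fact fps_mulDl : left_distributive fps_mul +%R.
Proof.
move=> f g h; apply/fpsP=> n /=; rewrite -big_split /=.
by apply: eq_bigr => i _; rewrite mulrDl.
Qed.
Fact fps_one_neq0 : fps_one != 0.
Proof.
by apply/eqP=> /fpsP /(_ 0%N) /= /eqP; rewrite oner_eq0.
Qed.

HB.instance Definition _ := GRing.Zmodule_isComNzRing.Build (fps R)
  fps_mulA fps_mulC fps_mul1 fps_mulDl fps_one_neq0.

Lemma fcoefM f g n :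
  fcoef (f * g) n = \sum_(i < n.+1) fcoef f i * fcoef g (n - i).
Proof. by []. Qed.
Lemma fcoef1 n : fcoef (1 : fps R) n = (n == 0%N)%:R.
Proof. by rewrite /=; case: eqP. Qed.
End ComRing.

(* The sequence whose [n]-th term is the value of [next] at the list of the
   terms of index less than [n]. *)
Definition course_of_values (T : Type) (next : seq T -> T) (n : nat) : T :=
  next (iter n (fun s => rcons s (next s)) [::]).

Lemma course_of_valuesE (T : Type) (next : seq T -> T) n :
  course_of_values next n = next (mkseq (course_of_values next) n).
Proof.
rewrite {1}/course_of_values; congr (next _).
by elim: n => //= n IHn; rewrite mkseqS -IHn.
Qed.

Section ComUnitRing.
Variable R : comUnitRingType.
Implicit Types f g h : fps R.

Definition fps_unit : {pred fps R} := [pred f | fcoef f 0 \is a GRing.unit].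

(* If f is invertible then g = f^-1 is given by g_0 = f_0^-1 and
   g_n = - f_0^-1 * \sum_(i < n) g_i * f_(n - i) for n > 0. *)
Definition fps_inv f : fps R :=
  if f \in fps_unit then
    Fps (course_of_values (fun s =>
      if nilp s then (fcoef f 0)^-1
      else - (fcoef f 0)^-1 *
           (\sum_(i < size s) s`_i * fcoef f (size s - i))))
  else f.

Fact fps_mulV : {in fps_unit, left_inverse 1 fps_inv *%R}.
Proof.
move=> f Uf; apply/fpsP=> n; rewrite fcoefM big_ord_recr /= subnn.
rewrite /fps_inv Uf /= [X in _ + X * _]course_of_valuesE /nilp size_mkseq.
case: n => [|n] /=; first by rewrite big_ord0 add0r mulVr.
under [X in _ + (_ * X) * _]eq_bigr => i _ do rewrite nth_mkseq //.
by rewrite mulNr mulNr mulrAC mulVr // mul1r subrr.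
Qed.
Fact fps_unitP f g : g * f = 1 -> f \in fps_unit.
Proof.
move=> /fpsP/(_ 0%N); rewrite fcoefM big_ord1 /= => gf1.
by apply/unitrP; exists (fcoef g 0); split; rewrite // mulrC.
Qed.
Fact fps_inv_out : {in [predC fps_unit], fps_inv =1 id}.
Proof. by move=> f; rewrite inE /= /fps_inv => /negPf->. Qed.

HB.instance Definition _ := GRing.ComNzRing_hasMulInverse.Build (fps R)
  fps_mulV fps_unitP fps_inv_out.

Lemma fps_unitE f : (f \is a GRing.unit) = (fcoef f 0 \is a GRing.unit).
Proof. by []. Qed.

(* For f with constant coefficient 1, and 2 invertible in R, the square root of
   f with constant coefficient 1 (see fps_sqrt_unique below). *)
Definition fps_sqrt f : fps R :=
  Fps (course_of_values (fun s =>
    if nilp s then 1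
    else (fcoef f (size s)
          - \sum_(1 <= i < size s) s`_i * s`_(size s - i)) / 2)).

Lemma fcoef0_sqrt f : fcoef (fps_sqrt f) 0 = 1.
Proof. by []. Qed.

Lemma fps_sqr_sqrt f : (2 : R) \is a GRing.unit -> fcoef f 0 = 1 ->
  fps_sqrt f ^+ 2 = f.
Proof.
move=> U2 f0; apply/fpsP=> -[|n].
  by rewrite expr2 fcoefM big_ord1 subnn fcoef0_sqrt mulr1 f0.
rewrite expr2 fcoefM big_ord_recr big_ord_recl /= subnn subn0.
rewrite -[course_of_values _ 0]/1 mul1r mulr1.
set u := course_of_values _; set S := \sum_(i < n) _.
have -> : u n.+1 = (fcoef f n.+1 - S) / 2.
  rewrite /u course_of_valuesE /nilp size_mkseq /= -/u.
  rewrite big_add1 big_mkord /S; congr ((_ - _) / _); apply: eq_bigr => i _.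
  by rewrite !nth_mkseq ?ltnS ?subSS ?leq_subr.
by rewrite addrAC -mulrDl -mulr2n -[_ *+ 2]mulr_natr mulrK // subrK.
Qed.

Lemma fps_sqrt_unique f g : (2 : R) \is a GRing.unit ->
  fcoef g 0 = 1 -> g ^+ 2 = f -> g = fps_sqrt f.
Proof.
move=> U2 g0 gf.
have f0 : fcoef f 0 = 1 by rewrite -gf expr2 fcoefM big_ord1 g0 mulr1.
have Us : g + fps_sqrt f \is a GRing.unit.
  by rewrite fps_unitE fcoefD g0 fcoef0_sqrt.
apply/eqP; rewrite -subr_eq0 -(mulIr_eq0 _ (mulIr Us)) -subr_sqr gf.
by rewrite fps_sqr_sqrt // subrr.
Qed.
End ComUnitRing.

(** * The generating function *)

(* The coefficient ring is Q[x2, x5]: the denominators of the identity have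
   constant coefficient 2. *)
Definition x2 : {mpoly rat[2]} := 'X_0.
Definition x5 : {mpoly rat[2]} := 'X_1.

Definition F25 : fps {mpoly rat[2]} :=
  1 + Fps (fun n => if n == 0%N then 0
                    else \sum_(L in lattice_paths n)
                           x2 ^+ mch n P2 L * x5 ^+ mch n P5 L).

(* Main.v *)
Require Import Defs.
From mathcomp Require Import all_boot all_algebra.
From mathcomp Require Import boolp mpoly.
From mathcomp Require Import zify ring.

(* Since the j-th N of L precedes the (j+1)-st E and follows the j-th E exactly
   when it ends at the diagonal point (j, j), a match of ENEN at j is a factor
   NE of L at (j, j), and a match of NENE is a factor EN at (j, j).  So x2
   (resp. x5) marks the consecutive pairs of prime blocks of the bridge L that
   both lie below (resp. above) the diagonal.  A prime block has generating
   function a = (1 - sqrt (1 - 4 t)) / 2, with t = a - a^2, hence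
     F = (1 + a - x2 a) (1 + a - x5 a) / ((1 - x2 a) (1 - x5 a) - a^2).
   No block decomposition of words is needed: the series "ending at the origin
   from a state (distance to the diagonal, last step)" satisfy the one-step
   recurrence of the weighted word counts, which determines them. *)

Set Implicit Arguments.
Unset Strict Implicit.
Unset Printing Implicit Defensive.

Import GRing.Theory.

(** * Pair matches as bounces on the diagonal *)

Definition other (s : step) : step := ~~ s.

(* c x is the number of letters x that precede the suffix under consideration. *)
Definition read (s : step) (c : step -> nat) (x : step) : nat := (s == x) + c x.

(** Carrying the letter counts of the prefix in [c] opens [ps] to induction on the remaining
    word. *)
Fixpoint ps_from (A : {pred nat}) (c : step -> nat) (w : seq step) : seq step :=
  if w is s :: w' then
    let r := ps_from A (read s c) w' in
    if (c s).+1 \in A then s :: r else r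
  else [::].

Lemma occ_cons0 s w : occ (s :: w) 0 = 1.
Proof. by rewrite /occ /= take0 /= eqxx. Qed.

Lemma occ_consS s w k : occ (s :: w) k.+1 = (s == nth E w k) + occ w k.
Proof. by []. Qed.

Lemma ps_fromE A c w :
  ps_from A c w =
  mask [seq c (nth E w k) + occ w k \in A | k <- iota 0 (size w)] w.
Proof.
elim: w c => //= s w IHw c; rewrite occ_cons0 addn1 (iotaDl 1 0) -map_comp IHw.
suff -> : [seq read s c (nth E w k) + occ w k \in A | k <- iota 0 (size w)] =
  [seq ((fun k => c (nth E (s :: w) k) + occ (s :: w) k \in A) \o addn 1) k
     | k <- iota 0 (size w)] by [].
by apply: eq_map => k /=; rewrite occ_consS /read addnCA addnA.
Qed.

Lemma psE w A : ps w A = ps_from A (fun=> 0) w.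
Proof. by rewrite ps_fromE. Qed.

(** A bounce is a visit to (j, j) entered by [other a] and left by [a]; [d] is the last letter read,
    [None] at the start. *)
Fixpoint bounce_at (a : step) (j : nat) (c : step -> nat) (d : option step)
    (w : seq step) : bool :=
  if w is s :: w' then
    [&& c a == j, c (other a) == j, d == Some (other a) & s == a]
    || bounce_at a j (read s c) (Some s) w'
  else false.

Lemma read_same a c : (read a c a = (c a).+1) * (read a c (other a) = c (other a)).
Proof. by rewrite /read; case: a. Qed.

Lemma read_other a c :
  (read (other a) c a = c a) * (read (other a) c (other a) = (c (other a)).+1).
Proof. by rewrite /read; case: a. Qed.

Variant letter_spec (a : step) : step -> Type :=
  | LetterSame : letter_spec a a
  | LetterOther : letter_spec a (other a).

Lemma letterP a s : letter_spec a s.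
Proof. by case: a s => -[]; constructor. Qed.

Lemma negb_eqF (a : step) : ((other a == a) = false) * ((a == other a) = false).
Proof. by case: a. Qed.

Definition num (x : step) (w : seq step) : nat := count_mem x w.

Lemma num_cons x s w : num x (s :: w) = (s == x) + num x w.
Proof. by []. Qed.

Lemma num_gt_mem (a : step) (w : seq step) m n :
  m < n + num a w -> n <= m -> a \in w.
Proof.
move=> mn nm; case: (boolP (a \in w)) => // /count_memPn a0.
by move: mn; rewrite /num a0 addn0 ltnNge nm.
Qed.

Definition readE := (read_same, read_other, negb_eqF).

(** Either (j, j) is already passed or was just entered by [a], or the [j]-th [other a] precedes the
    [j]-th [a], so that only [a] can complete an arrival at (j, j). *)
Lemma bounce_at_out a j c d w :
  [|| j < c a, j < c (other a), (c a < j) && (j <= c (other a)) |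
      [&& c a == j, c (other a) == j & d == Some a]] ->
  bounce_at a j c d w = false.
Proof.
elim: w c d => //= s w IHw c d Hc; apply/norP; split.
  apply/negP => /and4P[/eqP ca /eqP cb /eqP db _]; move: Hc.
  by rewrite ca cb db [_ == Some a]negb_eqF; lia.
apply/negP; rewrite IHw //; move: Hc.
by case: (letterP a s); rewrite !readE ?eqxx; lia.
Qed.

Section PairStatistic.
Variables (a : step) (j : nat).
Local Notation A := (pred2 j j.+1).

Lemma ps_from_nil c w : j < c a -> j < c (other a) -> ps_from A c w = [::].
Proof.
elim: w c => //= s w IHw c ca cb.
have -> : ((c s).+1 \in A) = false by case: (letterP a s); rewrite !inE; lia.
by apply: IHw; case: (letterP a s); rewrite !readE; lia.
Qed.

Lemma ps_from_other c w : j < c a -> c (other a) = j -> other a \in w ->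
  ps_from A c w = [:: other a].
Proof.
elim: w c => //= s w IHw c ca cb; rewrite inE.
case: (letterP a s) => [|_]; rewrite ?negb_eqF /=.
  move=> aw; rewrite !inE ifF; last by lia.
  by apply: IHw => //; rewrite !readE //; lia.
by rewrite cb !inE eqxx orbT ps_from_nil // !readE; lia.
Qed.

Lemma ps_from_bounce c w : c a = j -> c (other a) = j -> a \in w -> other a \in w ->
  (ps_from A c w == [:: a; other a]) = bounce_at a j c (Some (other a)) w.
Proof.
case: w => //= s w ca cb; rewrite !inE ca cb !eqxx.
case: (letterP a s); rewrite /= ?ca ?cb !eqxx !orbT ?eqseq_cons ?negb_eqF ?eqxx /=.
  by move=> _ bw; rewrite ps_from_other ?eqxx // !readE ?ca.
by move=> _ _; rewrite bounce_at_out // !readE cb ltnSn orbT.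
Qed.

(** After the first kept [a], the [j]-th [other a] must come next and ends at (j, j); another [a]
    before it is kept as well and carries the path past (j, j). *)
Lemma ps_from_same3 c d w : c a = j -> c (other a) < j ->
  j < c a + num a w -> j < c (other a) + num (other a) w ->
  (ps_from A c w == [:: other a; a; other a]) = bounce_at a j c d w.
Proof.
elim: w c d => [|s w IHw] c d ca cb; rewrite ?num_cons /=; first by lia.
rewrite [c (other a) == j]ltn_eqF // andbF /=.
case: (letterP a s); rewrite ?negb_eqF ?eqxx => na nb.
  rewrite ca !inE eqxx orbT eqseq_cons !negb_eqF /=.
  by rewrite bounce_at_out // !readE ca ltnSn.
rewrite !inE; case: (ltngtP (c (other a)).+1 j) cb => // cb _.
  rewrite ltn_eqF; last by lia.
  by apply: IHw; rewrite !readE; lia.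
rewrite eqseq_cons eqxx -ps_from_bounce ?readE //.
  by apply: (num_gt_mem na); rewrite ca.
by move: nb; rewrite addnA addn1 => /num_gt_mem; apply; rewrite cb.
Qed.

(** The first kept letter is the earlier of the two [j]-th occurrences. If it is [other a], the
    match fails, and (j, j) can only be entered by [a]. *)
Lemma ps_from_pair c d w : c a < j -> c (other a) < j ->
  j < c a + num a w -> j < c (other a) + num (other a) w ->
  (ps_from A c w == [:: a; other a; a; other a]) = bounce_at a j c d w.
Proof.
elim: w c d => [|s w IHw] c d ca cb; rewrite ?num_cons /=; first by lia.
rewrite [c (other a) == j]ltn_eqF // andbF /=.
case: (letterP a s); rewrite ?negb_eqF ?eqxx => na nb; rewrite !inE.
  case: (ltngtP (c a).+1 j) ca => // ca _.
    rewrite ltn_eqF; last by lia.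
    by apply: IHw; rewrite !readE; lia.
  by rewrite eqseq_cons eqxx; apply: ps_from_same3; rewrite !readE; lia.
case: (ltngtP (c (other a)).+1 j) cb => // cb _.
  rewrite ltn_eqF; last by lia.
  by apply: IHw; rewrite !readE; lia.
by rewrite eqseq_cons negb_eqF bounce_at_out // !readE ca -cb leqnn !orbT.
Qed.

End PairStatistic.

(* The diagonal is detected by the numbers of letters still to be read, which is
   the same as comparing the letters already read when the word is balanced. *)
Fixpoint bounces (a : step) (d : option step) (w : seq step) : nat :=
  if w is s :: w' then
    [&& num a w == num (other a) w, d == Some (other a) & s == a]
    + bounces a (Some s) w'
  else 0.

(** Each bounce lies at exactly one diagonal point, so summing over [j] counts the bounces of the
    word; the condition on [d] keeps them away from the origin. *)
Lemma count_bounce_at a n c (d : option step) w :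
  c a + num a w = n -> c (other a) + num (other a) w = n ->
  (d -> 0 < c a + c (other a)) ->
  count (fun j => bounce_at a j c d w) (iota 1 n.-1) = bounces a d w.
Proof.
elim: w c d => [|s w IHw] c d; first by rewrite count_pred0.
move=> na nb d_c; rewrite /bounces -/bounces.
rewrite -(IHw (read s c)); first last.
- by case: (letterP a s); rewrite !readE; lia.
- by move: nb => /=; case: (letterP a s); rewrite !readE ?eqxx /=; lia.
- by move: na => /=; case: (letterP a s); rewrite !readE ?eqxx /=; lia.
set p := fun j => [&& c a == j, c (other a) == j, d == Some (other a) & s == a].
set q := fun j => bounce_at a j (read s c) (Some s) w.
have := count_predUI p q (iota 1 n.-1).
(* Once [a] is read at (j, j), its count exceeds [j], so head and tail cannot both bounce at [j]. *)
have -> : count (predI p q) (iota 1 n.-1) = 0.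
  rewrite (eq_count (a2 := pred0)) ?count_pred0 // => j /=.
  apply/negP => /andP[/and4P[/eqP ca _ _ /eqP sE]].
  by rewrite /q sE bounce_at_out // !readE ca ltnSn.
rewrite addn0 => ->; congr (_ + _).
have -> : (num a (s :: w) == num (other a) (s :: w)) = (c a == c (other a)).
  by lia.
case: (boolP [&& _, _ & _]) => [/and3P[/eqP cab /eqP dE /eqP sE] | /negP cond].
  transitivity (count_mem (c a) (iota 1 n.-1)).
    by apply: eq_count => j; rewrite /p -cab dE sE !eqxx !andbT andbb eq_sym.
  (* [c a] lies between 1 and n - 1: some letter has been read, and an [a] is still to come. *)
  rewrite count_uniq_mem ?iota_uniq // mem_iota.
  by move: na d_c; rewrite dE sE num_cons -cab eqxx => + /(_ isT); lia.
rewrite (eq_count (a2 := pred0)) ?count_pred0 // => j /=.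
apply/negP => /and4P[/eqP ca /eqP cb d1 s1].
by case: cond; rewrite ca cb d1 s1 eqxx.
Qed.

Lemma mchE a n (L : (n + n).-tuple step) : L \in lattice_paths n ->
  mch n [:: a; other a; a; other a] L = bounces a None L.
Proof.
rewrite inE => /andP[/eqP nE /eqP nN].
have na b : num b L = n by case: b.
rewrite -(@count_bounce_at a n (fun=> 0)) ?na //.
apply: eq_in_count => j; rewrite mem_iota psE => jn.
by apply: ps_from_pair; rewrite ?na; lia.
Qed.

Local Open Scope ring_scope.

(** * Weighted word counts and their recurrence *)

Lemma big_tuple_cons (V : nmodType) m (f : seq bool -> V) :
  \sum_(w : m.+1.-tuple bool) f w =
  \sum_(w : m.-tuple bool) f (true :: w) +
  \sum_(w : m.-tuple bool) f (false :: w).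
Proof.
pose g (p : bool * m.-tuple bool) : m.+1.-tuple bool := [tuple of p.1 :: p.2].
rewrite (reindex g); last first.
  exists (fun t => (thead t, [tuple of behead t])) => [[b t] _ | t _].
    by congr pair; apply: val_inj.
  by rewrite /g /= -tuple_eta.
by rewrite -(pair_bigA _ (fun (b : bool) (t : m.-tuple bool) => f (b :: t))) big_bool.
Qed.

Lemma fcoefXM_0 (R : comNzRingType) (f : fps R) : fcoef (fpsX * f) 0 = 0.
Proof. by rewrite fcoefM big_ord1 mul0r. Qed.

Lemma fcoefXM_S (R : comNzRingType) (f : fps R) n :
  fcoef (fpsX * f) n.+1 = fcoef f n.
Proof.
rewrite fcoefM big_ord_recl mul0r add0r big_ord_recl /= mul1r subSS subn0.
by rewrite big1 ?addr0 // => i _; rewrite mul0r.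
Qed.

Lemma fcoefCM (R : comNzRingType) (x : R) (f : fps R) n :
  fcoef (fpsC x * f) n = x * fcoef f n.
Proof.
rewrite fcoefM big_ord_recl /= subn0 big1 ?addr0 // => i _.
by rewrite mul0r.
Qed.

#[local] Arguments fcoef : simpl never.

Section Bounces.
Variables (R : comNzRingType) (p q : R).

Definition weight (d : option step) (w : seq step) : R :=
  p ^+ bounces E d w * q ^+ bounces N d w.

Definition weight_sum (m : nat) (d : option step) (i k : nat) : R :=
  \sum_(w : m.-tuple step)
     (if (num E w == i) && (num N w == k) then weight d w else 0).

Lemma weight_sum0 d i k :
  weight_sum 0 d i k = if (i == 0%N) && (k == 0%N) then 1 else 0.
Proof.
rewrite /weight_sum (big_pred1 [tuple]) => [|t]; last first.
  by rewrite [t]tuple0 /= eqxx.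
by rewrite /= /weight /= mulr1 ![0%N == _]eq_sym.
Qed.

Lemma weight_sumS m d i k :
  weight_sum m.+1 d i k =
  (if i is i'.+1 then
     p ^+ ((i == k) && (d == Some N)) * weight_sum m (Some E) i' k else 0) +
  (if k is k'.+1 then
     q ^+ ((i == k) && (d == Some E)) * weight_sum m (Some N) i k' else 0).
Proof.
rewrite /weight_sum.
rewrite (@big_tuple_cons _ m (fun w =>
  if (num E w == i) && (num N w == k) then weight d w else 0)).
congr (_ + _).
  case: i => [|i]; first by rewrite big1 // => w _.
  rewrite big_distrr /=; apply: eq_bigr => w _ /=.
  rewrite add0n add1n eqSS.
  case: ifP => [/andP[/eqP <- /eqP <-]|_]; last by rewrite mulr0.
  rewrite /weight /= !add0n add1n !andbT !andbF !add0n.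
  by rewrite exprD mulrA.
case: k => [|k]; first by rewrite big1 // => w _; rewrite andbF.
rewrite big_distrr /=; apply: eq_bigr => w _ /=.
rewrite add0n add1n eqSS.
case: ifP => [/andP[/eqP <- /eqP <-]|_]; last by rewrite mulr0.
rewrite /weight /= !add0n add1n !andbT !andbF !add0n.
by rewrite exprD mulrCA eq_sym.
Qed.

Variables (C : fps R) (A : option step -> fps R).
Hypothesis CE : C = 1 + fpsX * C ^+ 2.
(** From the diagonal a path stops or makes a prime block, with series [fpsX * C]. A block starting
    with E ends with N and costs [p] if the last letter was N; symmetrically for [q]. *)
Hypothesis AE : forall d,
  A d = 1 + fpsC (p ^+ (d == Some N)) * (fpsX * (C * A (Some N)))
          + fpsC (q ^+ (d == Some E)) * (fpsX * (C * A (Some E))).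

(** This is the first-step recurrence off the diagonal: a step inwards leaves [h] passages, a step
    outwards leaves [h + 2] and costs a factor [fpsX]. *)
Let C_exprS h (f : fps R) :
  C ^+ h.+1 * f = C ^+ h * f + fpsX * (C ^+ h.+2 * f).
Proof. by rewrite exprS {1}CE !exprS; ring. Qed.

(* A path with i steps E and k steps N to go, i < k, first makes k - i first
   passages to the adjacent diagonal, each counted by C, and reaches the main
   diagonal by N, whence A (Some N). *)
Definition state_series (d : option step) (i k : nat) : R :=
  if (i < k)%N then fcoef (C ^+ (k - i) * A (Some N)) i
  else if (k < i)%N then fcoef (C ^+ (i - k) * A (Some E)) k
  else fcoef (A d) i.

Lemma weight_sumE m d i k : (i + k)%N = m ->
  weight_sum m d i k = state_series d i k.
Proof.
elim: m d i k => [|m IHm] d i k ikm.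
  have [-> ->] : i = 0%N /\ k = 0%N by lia.
  rewrite weight_sum0 /state_series /= AE !fcoefD !fcoefCM !fcoefXM_0.
  by rewrite !mulr0 !addr0.
rewrite weight_sumS /state_series.
case: (ltngtP i k) => [ik|ki|ik]; rewrite /= ?mul1r.
- have [h kE] : exists h, k = (i + h).+1 by exists (k - i).-1; lia.
  rewrite kE {ik} in ikm *; rewrite IHm; last by lia.
  have -> : ((i + h).+1 - i = h.+1)%N by lia.
  have -> : state_series (Some N) i (i + h) = fcoef (C ^+ h * A (Some N)) i.
    (* From distance 1 the step N lands on the diagonal, where the power of [C] is empty. *)
    rewrite /state_series; case: h {kE ikm} => [|h].
      by rewrite addn0 ltnn mul1r.
    by rewrite ifT ?addKn //; lia.
  rewrite C_exprS fcoefD addrC expr0 mul1r; congr (_ + _).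
  case: i {kE} ikm => [|i] ikm; first by rewrite fcoefXM_0.
  rewrite fcoefXM_S expr0 mul1r IHm; last by lia.
  rewrite /state_series ifT; last by lia.
  by congr (fcoef (C ^+ _ * _) _); lia.
- have [h kE] : exists h, i = (k + h).+1 by exists (i - k).-1; lia.
  rewrite kE {ki} in ikm *; rewrite IHm; last by lia.
  have -> : ((k + h).+1 - k = h.+1)%N by lia.
  have -> : state_series (Some E) (k + h) k = fcoef (C ^+ h * A (Some E)) k.
    rewrite /state_series; case: h {kE ikm} => [|h].
      by rewrite addn0 ltnn mul1r.
    by rewrite ifF ?ifT ?addKn //; lia.
  rewrite C_exprS fcoefD expr0 mul1r; congr (_ + _).
  case: k {kE} ikm => [|k] ikm; first by rewrite fcoefXM_0.
  rewrite fcoefXM_S expr0 mul1r IHm; last by lia.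
  rewrite /state_series ifF ?ifT; [|lia|lia].
  by congr (fcoef (C ^+ _ * _) _); lia.
(* Both letters lead from the diagonal to distance 1; the constant 1 in [AE] vanishes in positive
   degree. *)
rewrite -{k}ik in ikm *; case: i ikm => [|i] ikm; first by lia.
rewrite !IHm; try lia.
rewrite /state_series !ltnSn ltnNge leqnSn /= !subSnn !expr1.
by rewrite [A d]AE !fcoefD !fcoefCM !fcoefXM_S fcoef1 add0r.
Qed.

Lemma sum_lattice_paths n :
  \sum_(L in lattice_paths n) p ^+ mch n P2 L * q ^+ mch n P5 L
  = fcoef (A None) n.
Proof.
transitivity (weight_sum (n + n) None n n).
  rewrite /weight_sum [LHS]big_mkcond; apply: eq_bigr => L _.
  have -> : (num E L == n) && (num N L == n) = (L \in lattice_paths n).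
    by rewrite inE.
  case: ifP => // nL.
  by rewrite (mchE E nL) (mchE N nL).
by rewrite weight_sumE // /state_series ltnn.
Qed.

End Bounces.

(** * Algebra of the closed form *)

Lemma fcoefM0 (R : comNzRingType) (f g : fps R) :
  fcoef (f * g) 0 = fcoef f 0 * fcoef g 0.
Proof. by rewrite fcoefM big_ord1. Qed.

Lemma fpsX_inj (R : comNzRingType) : injective ( *%R (@fpsX R)).
Proof.
move=> f g /= fg; apply/fpsP => n.
by rewrite -(fcoefXM_S f) -(fcoefXM_S g) fg.
Qed.

Lemma fpsC1 (R : comNzRingType) : fpsC (1 : R) = 1.
Proof. by []. Qed.

(** Cramer's rule for the 2 by 2 system of the series after N and after E: [v] inverts the
    determinant, and swapping [y] and [z] gives the other equation. *)
Lemma block_series_eq (S : comNzRingType) (a y z v : S) :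
  ((1 - y * a) * (1 - z * a) - a ^+ 2) * v = 1 ->
  (1 - z * a + a) * v =
  1 + y * (a * ((1 - z * a + a) * v)) + a * ((1 - y * a + a) * v).
Proof. by move=> Dv; rewrite -[X in _ = X + _ + _]Dv; ring. Qed.

Lemma bridge_series_eq (S : comUnitRingType) (a t s y z v : S) :
  (2 : S) \is a GRing.unit -> 1 - z * a \is a GRing.unit ->
  s = 1 - 2 * a -> t = a - a ^+ 2 ->
  ((1 - y * a) * (1 - z * a) - a ^+ 2) * v = 1 ->
  1 + a * ((1 - z * a + a) * v) + a * ((1 - y * a + a) * v) =
  (1 + (1 - s) / (2 - z * (1 - s))) *
  (1 - (2 * (1 - z) * t + (z - 2) * (1 - s)) /
       (1 + s + y * (z - 1) * (1 - s) - z + s * z + 2 * (1 - y * z) * t)).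
Proof.
move=> U2 Uz -> ->; set D := _ - a ^+ 2 => Dv.
have UD : D \is a GRing.unit by apply/unitrP; exists v; split; rewrite // mulrC.
have -> : v = D^-1 by apply: (mulrI UD); rewrite Dv mulrV.
have -> : 2 - z * (1 - (1 - 2 * a)) = 2 * (1 - z * a) by ring.
have -> : 1 - (1 - 2 * a) = 2 * a by ring.
have -> : 1 + (1 - 2 * a) + y * (z - 1) * (2 * a) - z + (1 - 2 * a) * z
  + 2 * (1 - y * z) * (a - a ^+ 2) = 2 * D by rewrite /D; ring.
have -> : 2 * (1 - z) * (a - a ^+ 2) + (z - 2) * (2 * a) =
  2 * (z * a ^+ 2 - a ^+ 2 - a) by ring.
have cancel2 (x u : S) : u \is a GRing.unit -> 2 * x / (2 * u) = x / u.
  by move=> Uu; rewrite invrM // mulrA mulrAC [2 * x]mulrC mulrK.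
rewrite !cancel2 //.
have -> : 1 + a / (1 - z * a) = (1 - z * a + a) / (1 - z * a).
  by rewrite mulrDl mulrV.
(* The factor [1 - z * a] split off here cancels the denominator of the first factor. *)
have -> : 1 - (z * a ^+ 2 - a ^+ 2 - a) / D =
  (1 - z * a) * (1 - y * a + a) / D.
  by rewrite -[X in X - _](mulrV UD) -mulrBl; congr (_ / _); rewrite /D; ring.
rewrite -[RHS]mulrA -[_ * _ / D]mulrA mulKr //.
rewrite -[X in X + _ + _](mulrV UD) !mulrA -!mulrDl; congr (_ / _).
by rewrite /D; ring.
Qed.

(** * The Catalan series and the final identity *)

Section Catalan.
Variables (R : comUnitRingType) (p q : R).
Hypothesis U2 : (2 : R) \is a GRing.unit.

Let s : fps R := fps_sqrt (1 - 4 * fpsX).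

Lemma sum_lattice_paths_fps :
  1 + Fps (fun n => if n == 0%N then 0
                    else \sum_(L in lattice_paths n)
                           p ^+ mch n P2 L * q ^+ mch n P5 L) =
  (1 + (1 - s) / (2 - fpsC q * (1 - s))) *
  (1 - (2 * (1 - fpsC q) * fpsX + (fpsC q - 2) * (1 - s)) /
       (1 + s + fpsC p * (fpsC q - 1) * (1 - s) - fpsC q + s * fpsC q
          + 2 * (1 - fpsC p * fpsC q) * fpsX)).
Proof.
have U2f : (2 : fps R) \is a GRing.unit by rewrite fps_unitE fcoefD fcoef1.
pose a := (1 - s) / 2.
have sE : s = 1 - 2 * a by rewrite /a mulrC divrK //; ring.
have s2 : s ^+ 2 = 1 - 4 * fpsX.
  apply: fps_sqr_sqrt => //.
  by rewrite fcoefB fcoef1 fcoefM0 mulr0 subr0.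
have tE : fpsX = a - a ^+ 2.
  have U4 : (4 : fps R) \is a GRing.unit.
    by rewrite (_ : 4 = 2 * 2) ?unitrM ?U2f //; ring.
  apply: (mulrI U4); have -> : 4 * fpsX = 1 - s ^+ 2 by rewrite s2; ring.
  by rewrite sE; ring.
have a0 : fcoef a 0 = 0.
  by rewrite /a fcoefM0 fcoefB fcoef1 fcoef0_sqrt subrr mul0r.
(* Since [a] has no constant term it is divisible by [fpsX]; the quotient is the Catalan series. *)
pose C : fps R := Fps (fun n => fcoef a n.+1).
have XC : fpsX * C = a.
  by apply/fpsP => -[|n]; rewrite ?fcoefXM_0 ?a0 ?fcoefXM_S.
have CE : C = 1 + fpsX * C ^+ 2.
  apply: fpsX_inj => /=.
  rewrite (_ : _ * (1 + _) = fpsX + (fpsX * C) ^+ 2); last by ring.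
  by rewrite XC tE subrK.
pose y := fpsC p; pose z := fpsC q.
pose D := (1 - y * a) * (1 - z * a) - a ^+ 2.
have UD : D \is a GRing.unit.
  rewrite fps_unitE /D !(fcoefB, fcoefM0, fcoef1, a0).
  by rewrite !(mulr0, subr0, mulr1) unitr1.
have Uz : 1 - z * a \is a GRing.unit.
  by rewrite fps_unitE !(fcoefB, fcoefM0, fcoef1, a0, mulr0, subr0) unitr1.
rewrite -(bridge_series_eq (a := a) (v := D^-1)) ?mulrV //.
pose AN := (1 - z * a + a) / D; pose AE := (1 - y * a + a) / D.
pose A (d : option step) : fps R :=
  match d with
  | None => 1 + a * AN + a * AE
  | Some b => if b then AE else AN
  end.
have AEq d : A d = 1 + fpsC (p ^+ (d == Some N)) * (fpsX * (C * A (Some N)))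
          + fpsC (q ^+ (d == Some E)) * (fpsX * (C * A (Some E))).
  rewrite !(mulrA fpsX) XC; case: d => [[]|] /=.
  - rewrite fpsC1 expr1 mul1r [RHS]addrAC; apply: block_series_eq.
    by rewrite [X in X - _]mulrC mulrV.
  - by rewrite fpsC1 expr1 mul1r; apply: block_series_eq; rewrite mulrV.
  by rewrite fpsC1 !mul1r.
rewrite -/AN -/AE -/(A None).
(* In degree 0 the inner series is 0 by definition and the leading 1 matches the constant term of
   [A None]. *)
apply/fpsP => -[|n].
  rewrite fcoefD fcoef1 (AEq None) !fcoefD !fcoefCM !fcoefXM_0 fcoef1.
  by rewrite !mulr0 !addr0.
by rewrite fcoefD fcoef1 add0r -(sum_lattice_paths CE AEq).
Qed.

End Catalan.

Theorem mainTheorem9 :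
  let t : fps {mpoly rat[2]} := fpsX in
  let X2 : fps {mpoly rat[2]} := fpsC x2 in
  let X5 : fps {mpoly rat[2]} := fpsC x5 in
  let s : fps {mpoly rat[2]} := fps_sqrt (1 - 4 * t) in
  F25 =
    (1 + (1 - s) / (2 - X5 * (1 - s))) *
    (1 - (2 * (1 - X5) * t + (X5 - 2) * (1 - s)) /
         (1 + s + X2 * (X5 - 1) * (1 - s) - X5 + s * X5
            + 2 * (1 - X2 * X5) * t)).
Proof.
apply: sum_lattice_paths_fps.
by rewrite -(rmorph_nat (@mpolyC 2 rat)) rmorph_unit // unitfE.
Qed.
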